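(* Let $\mathcal{A}$ be a complex unital Banach algebra and let $x_1,x_2,x_3\in\mathcal{A}$ satisfy $$x_1+x_2+x_3=\alpha_1+\alpha_2(x_1x_2+x_1x_3+x_2x_3)\quad\text{and}\quad x_1x_2x_3=\beta(x_1x_2+x_1x_3+x_2x_3)$$ for some $\alpha_1,\alpha_2,\beta\in\mathbb{C}$. Let $X=\{x_1,x_2,x_3,x_1x_2+x_1x_3+x_2x_3\}$. If any three of the four elements of $X$ are Drazin invertible (respectively, g-Drazin invertible), then the remaining one is also Drazin invertible (respectively, g-Drazin invertible).
   Context: $\mathcal{A}$ is a complex unital Banach algebra with unit $1$. An element $a\in\mathcal{A}$ is Drazin invertible if there exists $b\in\mathcal{A}$ with $ab=ba$, $bab=b$, and $(a(1-ab))^n=0$ for some $n\in\mathbb{N}$. It is generalized Drazin (g-Drazin) invertible if there exists $b\in\mathcal{A}$ with $ab=ba$, $bab=b$, and $a(1-ab)$ quasinilpotent (spectral radius $0$). *)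

(* Defs.v *)
From HB Require Import structures.
From mathcomp Require Import all_boot all_order all_algebra.
From mathcomp Require Import all_classical all_reals.
From mathcomp Require Import complex.
Set Implicit Arguments. Unset Strict Implicit. Unset Printing Implicit Defensive.
Import Order.TTheory GRing.Theory Num.Theory.
Local Open Scope ring_scope.
Local Open Scope classical_set_scope.

(* A unital Banach algebra over C = R[i] is given as a (nonzero) unital
   C-algebra with computable inverses [A : unitAlgType R[i]] together with a
   norm [nrm : A -> R] that is a complete, submultiplicative algebra norm with
   nrm 1 = 1.  (Hierarchy-Builder cannot join mathcomp's ring structures with
   mathcomp-analysis' normed modules over a different number field, so the
   norm is given as explicit data.) *)
Record banach_algebra_norm (R : realType) (A : unitAlgType R[i]) (nrm : A -> R)
    : Prop := BanachAlgebraNorm {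
  nrm_ge0 : forall x, 0 <= nrm x ;
  nrm_eq0 : forall x, nrm x = 0 -> x = 0 ;
  nrm_triangle : forall x y, nrm (x + y) <= nrm x + nrm y ;
  nrm_scale : forall (c : R[i]) x,
    real_complex R (nrm (c *: x)) = `|c| * real_complex R (nrm x) ;
  nrm_submult : forall x y, nrm (x * y) <= nrm x * nrm y ;
  nrm_one : nrm 1 = 1 ;
  nrm_complete : forall u : nat -> A,
    (forall e : R, 0 < e -> exists N : nat, forall m n : nat,
        (N <= m)%N -> (N <= n)%N -> nrm (u m - u n) < e) ->
    exists l : A, forall e : R, 0 < e -> exists N : nat, forall n : nat,
        (N <= n)%N -> nrm (u n - l) < e }.

Section Drazin.
Variables (R : realType) (A : unitAlgType R[i]).

Definition drazin_inverse (a b : A) : Prop :=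
  a * b = b * a /\ b * a * b = b /\ exists n : nat, (a * (1 - a * b)) ^+ n = 0.

Definition drazin_invertible (a : A) : Prop := exists b, drazin_inverse a b.

Definition spectrum (a : A) : set R[i] :=
  [set l | ~ (l%:A - a \is a GRing.unit)].

(* quasinilpotent: spectral radius 0, i.e. the spectrum is contained in {0}
   (the spectrum of an element of a complex Banach algebra is nonempty) *)
Definition quasinilpotent (a : A) : Prop := spectrum a `<=` [set 0].

Definition gdrazin_inverse (a b : A) : Prop :=
  a * b = b * a /\ b * a * b = b /\ quasinilpotent (a * (1 - a * b)).

Definition gdrazin_invertible (a : A) : Prop := exists b, gdrazin_inverse a b.

End Drazin.

Definition any_three_imply_fourth (T : Type) (P : T -> Prop) (a b c d : T) : Prop :=
  [/\ P b /\ P c /\ P d -> P a,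
      P a /\ P c /\ P d -> P b,
      P a /\ P b /\ P d -> P c &
      P a /\ P b /\ P c -> P d].

(* Main.v *)
(** An element a is g-Drazin invertible iff 1 - s a is invertible for all large
    scalars s, and Drazin invertible iff moreover the inverse grows at most
    polynomially in |s|.  The hypotheses give
      (1 - s x1)(1 - s x2)(1 - s x3) = (1 - alpha1 s)(1 - nu y)
    with y = x1 x2 + x1 x3 + x2 x3 and
    nu = s (alpha2 - s + beta s^2) / (1 - alpha1 s), which tends to infinity
    with s; conversely every large nu comes from a large s.  Hence these
    resolvent conditions for any three of x1, x2, x3, y yield the fourth.

    For the sufficiency of the resolvent condition, let b be a multiple of a
    such that 1 - z b is invertible for all |z| = 1.  The Riesz projection
    is the limit of (1 - b^N)^-1 for N = 2^k, a Riemann sum of the Cauchy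
    integral, since (1 - w^2)^-1 is the average of (1 - w)^-1 and (1 + w)^-1.
    Choosing the square roots of two numbers close together, one sees that
    passing from N to 2N shrinks the Lipschitz constant of z |-> (1 - z b^N)^-1
    by a factor 3/4, hence convergence. *)
Require Import Defs.
From HB Require Import structures.
From mathcomp Require Import all_boot all_order all_algebra.
From mathcomp Require Import ssrAC.
From mathcomp Require Import all_classical all_reals all_analysis.
From mathcomp Require Import complex ring lra.
Import Order.TTheory GRing.Theory Num.Theory numFieldNormedType.Exports.
Local Open Scope ring_scope.

(** Compactness in its near-covering form: near each [t0] every sufficiently large [B] works, so one
    [B] near infinity serves the whole segment. *)
Lemma segment_locally_bounded {R : realType} (lo hi : R) (f : R -> R) :
  (forall t0, lo <= t0 <= hi -> exists (d B : R), 0 < d /\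
     forall t, lo <= t <= hi -> `|t0 - t| < d -> f t <= B) ->
  exists B, forall t, lo <= t <= hi -> f t <= B.
Proof.
move=> H.
have /compact_near_coveringP/(_ R (pinfty_nbhs R)
  (fun B t => lo <= t <= hi -> f t <= B) _) cover := @segment_compact R lo hi.
have [|B HB] := filter_ex (cover _).
  move=> t0 /=; rewrite in_itv /= => /H[d [B [d0 fB]]].
  exists (ball t0 d, [set M | B < M]%classic).
    split; [exact: nbhsx_ballx | exact: nbhs_pinfty_gt (num_real B)].
  by move=> [t M] /= [t0t BM] tI; rewrite (le_trans (fB _ tI t0t)) // ltW.
by exists B => t tI; apply: HB => //=; rewrite in_itv.
Qed.

(** * Modulus, square roots and polynomial roots of complex numbers *)

Section ComplexModulus.
Context {R : realType}.
Implicit Types z w : R[i].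

(** The norm of [R[i]] takes values in [R[i]]; [cabs] brings it into [R], where [nrm] lives. *)
Definition cabs z : R := complex.Re `|z|.

Lemma cabsE z : (cabs z)%:C%C = `|z|.
Proof. by rewrite /cabs normc_def. Qed.

Lemma cabs_ge0 z : 0 <= cabs z.
Proof. by rewrite -ler0c cabsE. Qed.

Lemma cabsM z w : cabs (z * w) = cabs z * cabs w.
Proof. by apply: complexI; rewrite rmorphM /= !cabsE normrM. Qed.

Lemma cabsX z n : cabs (z ^+ n) = cabs z ^+ n.
Proof. by apply: complexI; rewrite rmorphXn /= !cabsE normrX. Qed.

Lemma cabsV z : cabs z^-1 = (cabs z)^-1.
Proof. by apply: complexI; rewrite fmorphV /= !cabsE normfV. Qed.

Lemma cabsN z : cabs (- z) = cabs z.
Proof. by rewrite /cabs normrN. Qed.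

Lemma cabs0 : cabs 0 = 0 :> R.
Proof. by rewrite /cabs normr0. Qed.

Lemma cabs1 : cabs 1 = 1 :> R.
Proof. by rewrite /cabs normr1. Qed.

Lemma cabsD z w : cabs (z + w) <= cabs z + cabs w.
Proof. by rewrite -lecR rmorphD /= !cabsE ler_normD. Qed.

Lemma cabs_lb z w : cabs z - cabs w <= cabs (z + w).
Proof. by rewrite -lecR rmorphB /= !cabsE lerB_normD. Qed.

Lemma cabs_eq0 z : (cabs z == 0) = (z == 0).
Proof. by rewrite -(inj_eq (@complexI R)) cabsE normr_eq0. Qed.

Lemma cabs_gt0 z : (0 < cabs z) = (z != 0).
Proof. by rewrite lt0r cabs_ge0 andbT cabs_eq0. Qed.

Lemma cabs_real (t : R) : cabs t%:C%C = `|t|.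
Proof. by apply: complexI; rewrite cabsE normc_def /= expr0n addr0 sqrtr_sqr. Qed.

Lemma cabs2 : cabs (2 : R[i]) = 2.
Proof. by rewrite -(rmorph_nat (real_complex R)) cabs_real ger0_norm. Qed.

Lemma cabs_sqr_eq1 z : cabs (z ^+ 2) = 1 -> cabs z = 1.
Proof.
by rewrite cabsX => /eqP; rewrite (@pexpr_eq1 _ _ 2) ?cabs_ge0 // => /eqP.
Qed.

Lemma sqr_cabs z : cabs z ^+ 2 = complex.Re z ^+ 2 + complex.Im z ^+ 2.
Proof.
by apply: complexI; rewrite add_Re2_Im2 rmorphXn /= cabsE.
Qed.

Lemma complex_sqrt z : exists w, w ^+ 2 = z.
Proof. by exists (sqrtC z); rewrite sqrtCK. Qed.

(* Of the two square roots of w, take the one closer to that of z; the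
   parallelogram law then bounds the sum of the roots away from 0. *)
Lemma sqrt_close z w : cabs z = 1 -> cabs w = 1 -> exists z' w',
  [/\ z' ^+ 2 = z, w' ^+ 2 = w & cabs (z' - w') <= 3 / 4 * cabs (z - w)].
Proof.
move=> z1 w1.
have [z' z'E] := complex_sqrt z; have [w' w'E] := complex_sqrt w.
have unit_sqrt u u' : u' ^+ 2 = u -> cabs u = 1 -> cabs u' ^+ 2 = 1.
  by move=> uE; rewrite -uE cabsX.
have := unit_sqrt _ _ z'E z1; have := unit_sqrt _ _ w'E w1.
rewrite !sqr_cabs => Hw Hz.
have prod u u' : cabs (u - u') * cabs (u + u') = cabs (u ^+ 2 - u' ^+ 2).
  by rewrite -cabsM subr_sqr.
have par : cabs (z' - w') ^+ 2 + cabs (z' + w') ^+ 2 = 4.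
  rewrite !sqr_cabs; move: Hw Hz; case: (z') (w') => [a b] [c d] /= H1 H2.
  have -> : (4 : R) = 2 * (c ^+ 2 + d ^+ 2) + 2 * (a ^+ 2 + b ^+ 2).
    by rewrite H1 H2; ring.
  by ring.
have p0 := cabs_ge0 (z' - w'); have q0 := cabs_ge0 (z' + w').
have pq := prod z' w'; rewrite z'E w'E in pq.
have [le_pq|/ltW le_qp] := lerP (cabs (z' - w')) (cabs (z' + w')).
  exists z', w'; split=> //; rewrite -pq.
  (* By [par], the larger of the two moduli has square at least 2, and [2 > (4/3)^2]. *)
  have : 4 / 3 <= cabs (z' + w') by nra.
  by nra.
exists z', (- w'); split=> //; first by rewrite sqrrN.
rewrite opprK -pq.
have : 4 / 3 <= cabs (z' - w') by nra.
by nra.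
Qed.

(* Otherwise every root has modulus at most t, hence so does |p(0)|^(1/d). *)
Lemma large_root (p : {poly R[i]}) (t : R) d : p \is monic -> size p = d.+1 ->
  0 <= t -> t ^+ d < cabs p.[0] -> exists z, root p z /\ t < cabs z.
Proof.
move=> pmon psz t0 big; have [r pE] := closed_field_poly_normal p.
rewrite (monicP pmon) scale1r in pE.
have rd : size r = d by move: psz; rewrite pE size_prod_XsubC => -[].
have [/hasP[z zr tz]|/hasPn small] := boolP (has (fun z => t < cabs z) r).
  by exists z; rewrite pE root_prod_XsubC.
suff : cabs p.[0] <= t ^+ d by rewrite leNgt big.
rewrite pE horner_prod -rd.
elim: (r) small => [|z s IH] small; first by rewrite big_nil cabs1 expr0.
rewrite big_cons cabsM exprS ler_pM ?cabs_ge0 //.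
  by rewrite hornerXsubC sub0r cabsN leNgt small // mem_head.
by apply: IH => w ws; apply: small; rewrite in_cons ws orbT.
Qed.

(** The equation is a polynomial one in [s]. Made monic, it has constant term [nu] (degree 2) if
    [be = 0] and [- nu / be] (degree 3) otherwise; the factor [1 + cabs be] makes either one large
    enough for [large_root]. *)
Lemma large_cubic_root (al1 al2 be nu : R[i]) (t : R) : 1 <= t ->
  t ^+ 3 * (1 + cabs be) < cabs nu ->
  exists s, t < cabs s /\ s * (al2 - s + be * s ^+ 2) = nu * (1 - al1 * s).
Proof.
move=> t1 big; have t0 : 0 <= t by lra.
have t3 : 1 <= t ^+ 3 by rewrite exprn_ege1.
have be0 := cabs_ge0 be.
have [b0|bN0] := eqVneq be 0.
  have [||||s [sroot ts]] := large_root (Poly [:: nu; - (al2 + nu * al1); 1]) t 2.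
  - by rewrite monicE lead_coefE (@PolyK _ 0) ?oner_eq0.
  - by rewrite (@PolyK _ 0) ?oner_eq0.
  - by [].
  - rewrite horner_Poly /= !mulr0 !add0r; apply: le_lt_trans big.
    by rewrite b0 cabs0 addr0 mulr1 ler_weXn2l.
  exists s; split=> //; move: sroot; rewrite /root horner_Poly /= => /eqP E.
  apply/eqP; rewrite -subr_eq0 b0 -oppr_eq0 -[X in _ == X]E; apply/eqP; ring.
have bE : 0 < cabs be by rewrite cabs_gt0.
have [||||s [sroot ts]] := large_root
  (Poly [:: - (nu / be); (al2 + nu * al1) / be; - be^-1; 1]) t 3.
- by rewrite monicE lead_coefE (@PolyK _ 0) ?oner_eq0.
- by rewrite (@PolyK _ 0) ?oner_eq0.
- by [].
- rewrite horner_Poly /= !mulr0 !add0r cabsN cabsM cabsV ltr_pdivlMr //; nra.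
exists s; split=> //; move: sroot; rewrite /root horner_Poly /= => /eqP E.
apply/eqP; rewrite -subr_eq0; apply/eqP; rewrite -[RHS](mulr0 be) -E; field.
by [].
Qed.

End ComplexModulus.

(** * Norm estimates, limits and the Neumann series *)

Section BanachAlgebra.
Context {R : realType} {A : unitAlgType R[i]} (nrm : A -> R).
Hypothesis hnrm : banach_algebra_norm nrm.
Implicit Types (a b x y z p : A) (u v w : nat -> A) (c s : R[i]).

Let N_ge0 x : 0 <= nrm x. Proof. exact: nrm_ge0 hnrm x. Qed.
Let N_tri x y : nrm (x + y) <= nrm x + nrm y. Proof. exact: nrm_triangle hnrm x y. Qed.
Let N_mul x y : nrm (x * y) <= nrm x * nrm y. Proof. exact: nrm_submult hnrm x y. Qed.
Let N_one : nrm 1 = 1. Proof. exact: nrm_one hnrm. Qed.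

Lemma nrmZ c x : nrm (c *: x) = cabs c * nrm x.
Proof. by apply: complexI; rewrite (nrm_scale hnrm) rmorphM /= cabsE. Qed.

Lemma nrm0 : nrm 0 = 0.
Proof. by rewrite -(scale0r (0 : A)) nrmZ cabs0 mul0r. Qed.

Lemma nrmN x : nrm (- x) = nrm x.
Proof. by rewrite -scaleN1r nrmZ cabsN cabs1 mul1r. Qed.

Lemma nrm_distC x y : nrm (x - y) = nrm (y - x).
Proof. by rewrite -nrmN opprB. Qed.

Lemma nrmB x y : nrm (x - y) <= nrm x + nrm y.
Proof. by rewrite -[nrm y]nrmN. Qed.

Lemma nrmX x n : nrm (x ^+ n) <= nrm x ^+ n.
Proof.
elim: n => [|n IH]; first by rewrite !expr0 N_one.
by rewrite !exprS (le_trans (N_mul _ _)) // ler_wpM2l.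
Qed.

Lemma geometric_small (K r e : R) : 0 <= K -> 0 <= r -> r < 1 -> 0 < e ->
  exists n0, forall n, (n0 <= n)%N -> K * r ^+ n < e.
Proof.
move=> K0 r0 r1 e0.
have /cvgrPdist_lt/(_ e e0)[n0 _ H] : (geometric K r x @[x --> \oo] --> 0)%classic.
  by apply: cvg_geometric; rewrite ger0_norm.
exists n0 => n /H /=; rewrite sub0r normrN ger0_norm //.
by rewrite mulr_ge0 // exprn_ge0.
Qed.

(** Written as the conclusion of [nrm_complete], so that completeness directly yields a [tends]. *)
Definition tends u x : Prop :=
  forall e : R, 0 < e -> exists n0, forall n, (n0 <= n)%N -> nrm (u n - x) < e.

(** A common source of the limit laws: sums and products use two sequences, one-sided multiplication
    takes [u = v]. *)
Lemma tends_squeeze {u v w x y z} (K : R) : 0 <= K -> tends u x -> tends v y ->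
  (forall n, nrm (w n - z) <= K * (nrm (u n - x) + nrm (v n - y))) -> tends w z.
Proof.
move=> K0 ux vy H e e0.
have d0 : 0 < e / (2 * (K + 1)) by rewrite divr_gt0 // mulr_gt0 // ltr_wpDl.
have [n1 H1] := ux _ d0; have [n2 H2] := vy _ d0.
exists (maxn n1 n2) => n; rewrite geq_max => /andP[/H1 h1 /H2 h2].
apply: le_lt_trans (H n) _.
have -> : e = (K + 1) * (e / (2 * (K + 1)) + e / (2 * (K + 1))) by field; lra.
move: (N_ge0 (u n - x)) (N_ge0 (v n - y)) => ? ?; nra.
Qed.

Lemma tends_uniq {u x y} : tends u x -> tends u y -> x = y.
Proof.
move=> ux uy; apply/eqP; rewrite -subr_eq0; apply/eqP/(nrm_eq0 hnrm).
apply/eqP; rewrite eq_le N_ge0 andbT; apply/ler_addgt0Pl => e e0; rewrite addr0.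
have e20 : 0 < e / 2 by lra.
have [n1 H1] := ux _ e20; have [n2 H2] := uy _ e20.
have := H1 _ (leq_maxl n1 n2); have := H2 _ (leq_maxr n1 n2).
set k := maxn _ _ => h2 h1; rewrite -(subrKA (u k)) (le_trans (N_tri _ _)) //.
rewrite nrm_distC; lra.
Qed.

Lemma tends_bound {u x} {B : R} n0 : tends u x ->
  (forall n, (n0 <= n)%N -> nrm (u n) <= B) -> nrm x <= B.
Proof.
move=> ux uB; apply/ler_addgt0Pl => e e0; have [n1 H1] := ux _ e0.
have := H1 _ (leq_maxl n1 n0); have := uB _ (leq_maxr n1 n0).
set k := maxn _ _ => h2 h1; rewrite -(subrK (u k) x) (le_trans (N_tri _ _)) //.
by rewrite nrm_distC lerD // ltW.
Qed.

Lemma tends_shift {u x} : tends u x -> tends (u \o succn) x.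
Proof. by move=> ux e /ux[n0 H]; exists n0 => n n0n; apply: H; exact: leqW. Qed.

Lemma tends_ext {u v x} : u =1 v -> tends u x -> tends v x.
Proof. by move=> uv ux e /ux[n0 H]; exists n0 => n /H; rewrite uv. Qed.

Lemma tends_mull {u x} y : tends u x -> tends (fun n => y * u n) (y * x).
Proof.
move=> ux; apply: (tends_squeeze (nrm y) (N_ge0 y) ux ux) => n.
rewrite -mulrBr (le_trans (N_mul _ _)) // ler_wpM2l //.
by rewrite lerDl.
Qed.

Lemma tends_mulr {u x} y : tends u x -> tends (fun n => u n * y) (x * y).
Proof.
move=> ux; apply: (tends_squeeze (nrm y) (N_ge0 y) ux ux) => n.
rewrite -mulrBl (le_trans (N_mul _ _)) // mulrC ler_wpM2l //.
by rewrite lerDl.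
Qed.

Lemma tends_sub {u v x y} : tends u x -> tends v y ->
  tends (fun n => u n - v n) (x - y).
Proof.
move=> ux vy; apply: (tends_squeeze 1 ler01 ux vy) => n.
by rewrite mul1r (_ : _ - _ = u n - x - (v n - y)) ?nrmB // !opprD addrACA.
Qed.

Lemma tends_geometric {u} (K r : R) : 0 <= K -> 0 <= r -> r < 1 ->
  (forall n, nrm (u n.+1 - u n) <= K * r ^+ n) -> exists x, tends u x.
Proof.
move=> K0 r0 r1 H; apply: (nrm_complete hnrm) => e e0.
(* Multiplied by [1 - r], the geometric sum becomes a telescoping difference, and the induction on
   [k] is linear arithmetic. *)
have step n k : (1 - r) * nrm (u (n + k)%N - u n) <= K * (r ^+ n - r ^+ (n + k)).
  elim: k => [|k IH]; first by rewrite addn0 !subrr nrm0 !mulr0.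
  have := N_tri (u (n + k).+1 - u (n + k)%N) (u (n + k)%N - u n).
  rewrite subrKA addnS exprS; have := H (n + k)%N.
  move: (r ^+ (n + k)) IH => t IH h1 h2.
  have : (1 - r) * nrm (u (n + k).+1 - u n) <=
    (1 - r) * (K * t + nrm (u (n + k)%N - u n)).
    by rewrite ler_pM2l; lra.
  lra.
have bnd n k : (1 - r) * nrm (u (n + k)%N - u n) <= K * r ^+ n.
  by rewrite (le_trans (step n k)) // ler_wpM2l // gerBl exprn_ge0.
have [|n0 Hn0] := geometric_small K r ((1 - r) * e / 2) K0 r0 r1.
  by rewrite divr_gt0 // mulr_gt0 //; lra.
have close n : (n0 <= n)%N -> nrm (u n - u n0) < e / 2.
  move=> /subnKC <-; rewrite -(ltr_pM2l (_ : 0 < 1 - r)); last by lra.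
  by rewrite mulrA (le_lt_trans (bnd _ _)) // Hn0.
exists n0 => m n /close hm /close hn.
rewrite -(subrKA (u n0)) (le_lt_trans (N_tri _ _)) //.
rewrite (nrm_distC (u n0)); lra.
Qed.

Lemma neumann x : nrm x < 1 -> 1 - x \is a GRing.unit.
Proof.
move=> x1; pose u n := \sum_(i < n) x ^+ i.
have [|s us] := @tends_geometric u 1 (nrm x) ler01 (N_ge0 x) x1.
  by move=> n; rewrite /u big_ord_recr /= addrAC subrr add0r mul1r nrmX.
have lim1 : tends (fun n => 1 - x ^+ n) 1.
  move=> e e0; have [n0 H] := geometric_small 1 (nrm x) e ler01 (N_ge0 x) x1 e0.
  exists n0 => n /H; rewrite mul1r; apply: le_lt_trans.
  by rewrite addrAC subrr add0r nrmN nrmX.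
have uE n : 1 - x ^+ n = (1 - x) * u n by rewrite -opprB subrX1 -mulNr opprB.
have uE' n : 1 - x ^+ n = u n * (1 - x).
  rewrite uE /u mulr_sumr mulr_suml; apply: eq_bigr => i _.
  by rewrite mulrBl mulrBr mul1r mulr1 -exprS -exprSr.
apply/unitrP; exists s; split.
  by apply: tends_uniq lim1; apply: tends_ext (tends_mulr (1 - x) us) => n.
by apply: tends_uniq lim1; apply: tends_ext (tends_mull (1 - x) us) => n.
Qed.

(** [1 - x] divides [1 - x^n] with a cofactor that commutes with it. *)
Lemma unit_of_pow x n : 1 - x ^+ n \is a GRing.unit -> 1 - x \is a GRing.unit.
Proof.
rewrite -opprB subrX1 -mulNr opprB unitrM_comm; first by case/andP.
apply: commr_sum => i _; apply: commrX; apply: commr_sym.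
by apply: commrB; [exact: commr1 | exact: commr_refl].
Qed.

(** * Averages of resolvents over the unit circle *)

Lemma sub_inv x y : x \is a GRing.unit -> y \is a GRing.unit ->
  x^-1 - y^-1 = x^-1 * (y - x) * y^-1.
Proof. by move=> Ux Uy; rewrite mulrBr mulrBl mulrK // mulVr // mul1r. Qed.

(** This is [1 / (x y) = (1/x + 1/y) / (x + y)]; the condition on the sum forces [x] and [y] to
    commute. *)
Lemma avg_inv x y : x + y = 1 + 1 -> x \is a GRing.unit -> y \is a GRing.unit ->
  x * y \is a GRing.unit /\ (x * y)^-1 = 2^-1 *: (x^-1 + y^-1).
Proof.
move=> xy2 Ux Uy; have yE : y = 1 + 1 - x by rewrite -xy2 addrC addKr.
have cxy : x * y = y * x by rewrite yE mulrBr mulrBl mulrDr mulrDl !mulr1 !mul1r.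
rewrite unitrM_comm // Ux Uy; split=> //.
apply: (scalerI (_ : (2 : R[i]) != 0)); first by rewrite pnatr_eq0.
rewrite scalerA mulfV ?pnatr_eq0 // scale1r cxy invrM //.
have -> : x^-1 + y^-1 = x^-1 * (x + y) * y^-1.
  by rewrite mulrDr mulrDl mulVr // mul1r mulrK // addrC.
by rewrite xy2 mulrDr mulr1 mulrDl scaler_nat mulr2n.
Qed.

(* The average of (1 - w b)^-1 over all 2^k-th roots w of s. *)
Definition dyadic_res b k s : A := (1 - s *: b ^+ (2 ^ k))^-1.

Lemma dyadic_factor b k s : 1 - s ^+ 2 *: b ^+ (2 ^ k.+1) =
  (1 - s *: b ^+ (2 ^ k)) * (1 - (- s) *: b ^+ (2 ^ k)).
Proof.
rewrite scaleNr opprK mulrDr mulr1 mulrBl mul1r addrA subrK.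
by rewrite -scalerAl -scalerAr scalerA -expr2 -exprD addnn -mul2n -expnS.
Qed.

(** Says that the spectrum of [b] misses the unit circle, as [1 - s b = s (s^-1 - b)]. *)
Definition regular_circle b : Prop :=
  forall s, cabs s = 1 -> 1 - s *: b \is a GRing.unit.

Lemma dyadic_unit b : regular_circle b -> forall k s, cabs s = 1 ->
  1 - s *: b ^+ (2 ^ k) \is a GRing.unit.
Proof.
move=> Ub; elim=> [|k IH] s s1; first by rewrite expn0 expr1; exact: Ub.
have [z zE] := complex_sqrt s; move: s1; rewrite -zE => /cabs_sqr_eq1 z1.
rewrite dyadic_factor unitrMl; first exact: IH.
by apply: IH; rewrite cabsN.
Qed.

Lemma dyadic_res_avg b : regular_circle b -> forall k s, cabs s = 1 ->
  dyadic_res b k.+1 (s ^+ 2) = 2^-1 *: (dyadic_res b k s + dyadic_res b k (- s)).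
Proof.
move=> Ub k s s1; rewrite /dyadic_res dyadic_factor.
apply: (proj2 (avg_inv _ _ _ _ _)); try by apply: dyadic_unit => //; rewrite ?cabsN.
by rewrite scaleNr opprK addrACA addNr addr0.
Qed.

(* Averaging over the two square roots does not increase the sup norm over
   the unit circle. *)
Lemma circle_avg_bound (G : nat -> R[i] -> A) (B : R) k0 :
  (forall k s, cabs s = 1 -> G k.+1 (s ^+ 2) = 2^-1 *: (G k s + G k (- s))) ->
  (forall s, cabs s = 1 -> nrm (G k0 s) <= B) ->
  forall k s, (k0 <= k)%N -> cabs s = 1 -> nrm (G k s) <= B.
Proof.
move=> Gavg GB k s /subnKC <-; elim: (k - k0)%N s => [|j IH] s s1.
  by rewrite addn0 GB.
have [z zE] := complex_sqrt s; move: s1; rewrite -zE => /cabs_sqr_eq1 z1.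
rewrite addnS Gavg // nrmZ cabsV.
rewrite cabs2.
have := IH z z1; have := IH (- z); rewrite cabsN => /(_ z1).
by have := N_tri (G (k0 + j)%N z) (G (k0 + j)%N (- z)); lra.
Qed.

(** The resolvent identity [sub_inv] gives the case [k = 0]. In the step, close roots are paired,
    [z] with [z'] and [-z] with [-z'], at the same distance, and the two differences are
    averaged. *)
Lemma dyadic_res_lip b (M : R) : regular_circle b ->
  (forall s, cabs s = 1 -> nrm (1 - s *: b)^-1 <= M) ->
  forall k s s', cabs s = 1 -> cabs s' = 1 ->
  nrm (dyadic_res b k s - dyadic_res b k s') <=
    M ^+ 2 * nrm b * (3 / 4) ^+ k * cabs (s - s').
Proof.
move=> Ub bM; elim=> [|k IH] s s' s1 s'1.
  rewrite /dyadic_res expn0 expr1 sub_inv; [|exact: Ub|exact: Ub].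
  have -> : 1 - s' *: b - (1 - s *: b) = (s - s') *: b.
    by rewrite opprB addrC addrA subrK scalerBl.
  rewrite expr0 mulr1.
  rewrite (le_trans (N_mul _ _)) //.
  have h := N_mul (1 - s *: b)^-1 ((s - s') *: b); rewrite nrmZ in h.
  have := bM _ s1; have := bM _ s'1.
  have := N_ge0 (1 - s *: b)^-1; have := N_ge0 (1 - s' *: b)^-1.
  have D0 : 0 <= cabs (s - s') * nrm b by rewrite mulr_ge0 // cabs_ge0.
  move: (nrm _^-1) (nrm _^-1) D0 (N_ge0 ((1 - s *: b)^-1 * ((s - s') *: b))) h.
  move=> p q D0 X0 h p0 q0 pM qM.
  apply: le_trans (_ : p * (cabs (s - s') * nrm b) * q <= _).
    by rewrite ler_wpM2r.
  have -> : M ^+ 2 * nrm b * cabs (s - s') = M * (cabs (s - s') * nrm b) * M by ring.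
  by apply: ler_pM => //; [exact: mulr_ge0 | rewrite ler_wpM2r].
have [z [z' [zE z'E zz']]] := sqrt_close s s' s1 s'1.
have z1 : cabs z = 1 by apply: cabs_sqr_eq1; rewrite zE.
have z'1 : cabs z' = 1 by apply: cabs_sqr_eq1; rewrite z'E.
rewrite -zE -z'E !dyadic_res_avg // zE z'E -scalerBr opprD addrACA nrmZ cabsV.
rewrite cabs2.
have Nz1 : cabs (- z) = 1 by rewrite cabsN.
have Nz'1 : cabs (- z') = 1 by rewrite cabsN.
have := IH _ _ z1 z'1; have := IH _ _ Nz1 Nz'1.
rewrite -opprD cabsN.
set x := dyadic_res b k z - _; set y := dyadic_res b k (- z) - _ => hy hx.
have K0 : 0 <= M ^+ 2 * nrm b * (3 / 4) ^+ k.
  by apply: mulr_ge0; [rewrite mulr_ge0 ?sqr_ge0 | apply: exprn_ge0; lra].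
have := N_tri x y; have := cabs_ge0 (z - z').
rewrite (exprS (3 / 4)); move: (M ^+ 2 * nrm b) hx hy K0 => K.
move: (_ ^+ k) => t hx hy; rewrite (mulrCA K) => K0 ? ?.
move: (K * t) hx hy K0 => L; nra.
Qed.
(** In [x^-1 - y^-1 = x^-1 (y - x) y^-1] the right side has norm at most half of [nrm y^-1], which
    is absorbed. *)
Lemma nrm_inv_near x y : x \is a GRing.unit -> y \is a GRing.unit ->
  nrm (x - y) * nrm x^-1 <= 1 / 2 -> nrm y^-1 <= 2 * nrm x^-1.
Proof.
move=> Ux Uy h; have := sub_inv _ _ Ux Uy => E.
have : nrm y^-1 <= nrm x^-1 + nrm (x^-1 - y^-1).
  by rewrite -[X in nrm X <= _](subKr x^-1) nrmB.
rewrite E; have := N_mul (x^-1 * (y - x)) y^-1; have := N_mul x^-1 (y - x).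
rewrite (nrm_distC y x); have := N_ge0 y^-1.
move: (nrm y^-1) (nrm (x - y)) h (nrm (_ * (y - x))) => p q h r; nra.
Qed.

(** The right half of the unit circle by its imaginary part; with its negative it covers the circle,
    so boundedness on the circle reduces to a real segment. *)
Definition half_circle (t : R) : R[i] := (Num.sqrt (1 - t ^+ 2) +i* t)%C.

Lemma cabs_half_circle t : -1 <= t <= 1 -> cabs (half_circle t) = 1.
Proof.
move=> t1; apply/eqP; rewrite -(@pexpr_eq1 _ _ 2) ?cabs_ge0 // sqr_cabs /=.
by rewrite sqr_sqrtr ?subrK //; nra.
Qed.

(** The parametrisation is only Hölder continuous of exponent 1/2 at the endpoints, hence the
    square. *)
Lemma half_circle_dist t t' : -1 <= t <= 1 -> -1 <= t' <= 1 ->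
  cabs (half_circle t - half_circle t') ^+ 2 <= 4 * `|t - t'|.
Proof.
move=> t1 t'1; rewrite sqr_cabs /=.
have h : 0 <= 1 - t ^+ 2 by nra.
have h' : 0 <= 1 - t' ^+ 2 by nra.
have := sqr_sqrtr h; have := sqr_sqrtr h'.
have := sqrtr_ge0 (1 - t ^+ 2); have := sqrtr_ge0 (1 - t' ^+ 2).
set r := Num.sqrt _; set r' := Num.sqrt _ => r0 r'0 rE r'E.
have e1 : (t - t') ^+ 2 <= 2 * `|t - t'|.
  by rewrite -real_normK ?num_real // expr2 ler_wpM2r // ler_norml; lra.
have e2 : `|t ^+ 2 - t' ^+ 2| <= 2 * `|t - t'|.
  by rewrite subr_sqr normrM mulrC ler_wpM2r // ler_norml; lra.
(* For nonnegative [r] and [r'] one has [(r' - r)^2 <= |r'^2 - r^2|]. *)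
have e3 : (r' - r) ^+ 2 <= `|t ^+ 2 - t' ^+ 2|.
  have [rr|rr] := lerP r r'.
    by have := ler_norm (- (t ^+ 2 - t' ^+ 2)); rewrite normrN; nra.
  by have := ler_norm (t ^+ 2 - t' ^+ 2); nra.
lra.
Qed.

Lemma half_circle_bounded b : regular_circle b ->
  exists B, forall t, -1 <= t <= 1 -> nrm (1 - half_circle t *: b)^-1 <= B.
Proof.
move=> Ub; apply: segment_locally_bounded => t0 t01.
have U0 := Ub _ (cabs_half_circle _ t01).
set x := 1 - half_circle t0 *: b in U0.
pose L := nrm b * nrm x^-1.
have L0 : 0 <= L by rewrite mulr_ge0.
(* At this radius [half_circle_dist] bounds the square of the quantity in [nrm_inv_near] by
   [4 L^2 / (16 (L^2 + 1)) <= (1/2)^2]; the [+ 1] covers [L = 0]. *)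
exists (1 / (16 * (L ^+ 2 + 1))), (2 * nrm x^-1); split.
  by rewrite divr_gt0 // mulr_gt0 // ltr_wpDl // sqr_ge0.
move=> t tI; rewrite ltr_pdivlMr; last by rewrite mulr_gt0 // ltr_wpDl // sqr_ge0.
move=> td; apply: nrm_inv_near => //; first exact: Ub (cabs_half_circle _ tI).
have -> : x - (1 - half_circle t *: b) = (half_circle t - half_circle t0) *: b.
  by rewrite /x opprB addrC addrA subrK scalerBl.
rewrite nrmZ -mulrA -/L.
have := half_circle_dist _ _ tI t01; rewrite distrC => dl.
rewrite -(@ler_pXn2r _ 2) ?nnegrE ?mulr_ge0 ?cabs_ge0 //; try lra.
rewrite exprMn; apply: le_trans (_ : 4 * `|t0 - t| * L ^+ 2 <= _).
  by rewrite ler_wpM2r // sqr_ge0.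
have := normr_ge0 (t0 - t); nra.
Qed.

(** The left half circle for [b] is the right half circle for [-b]. *)
Lemma circle_bounded b : regular_circle b ->
  exists B, forall s, cabs s = 1 -> nrm (1 - s *: b)^-1 <= B.
Proof.
move=> Ub; have [B HB] := half_circle_bounded _ Ub.
have [|B' HB'] := half_circle_bounded (- b).
  by move=> s s1; rewrite scalerN -scaleNr; apply: Ub; rewrite cabsN.
have param s : cabs s = 1 -> 0 <= complex.Re s ->
    -1 <= complex.Im s <= 1 /\ s = half_circle (complex.Im s).
  move=> s1 re0; have : cabs s ^+ 2 = 1 by rewrite s1 expr1n.
  case: s {s1} re0 => p q /= p0; rewrite sqr_cabs /= => pq.
  split; first by nra.
  rewrite /half_circle; congr (_ +i* _)%C.
  by rewrite -pq addrK sqrtr_sqr ger0_norm.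
exists (Num.max B B') => s s1; rewrite le_max.
have [re0|/ltW re0] := lerP 0 (complex.Re s).
  by have [sI ->] := param _ s1 re0; rewrite HB.
have [| |sI sE] := param (- s); rewrite ?cabsN //.
  by case: (s) re0 => p q /=; rewrite oppr_ge0.
by apply/orP; right; rewrite -[s]opprK scaleNr -scalerN sE HB'.
Qed.

Lemma dyadic_res_bounded b : regular_circle b ->
  exists B, forall k s, cabs s = 1 -> nrm (dyadic_res b k s) <= B.
Proof.
move=> Ub; have [B HB] := circle_bounded _ Ub; exists B => k s s1.
apply: (circle_avg_bound (dyadic_res b) B 0 (dyadic_res_avg _ Ub)) => //.
Qed.

(** Consecutive terms differ by half the difference of [dyadic_res b k] at [-1] and [1], which
    decays geometrically by [dyadic_res_lip]. *)
Lemma dyadic_res_tends b : regular_circle b ->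
  exists p, tends (fun k => dyadic_res b k 1) p.
Proof.
move=> Ub; have [B HB] := circle_bounded _ Ub.
have K0 : 0 <= B ^+ 2 * nrm b by rewrite mulr_ge0 ?sqr_ge0.
apply: (tends_geometric (B ^+ 2 * nrm b) (3 / 4)) => [//|||k]; try lra.
have -> : dyadic_res b k.+1 1 = 2^-1 *: (dyadic_res b k 1 + dyadic_res b k (-1)).
  by rewrite -dyadic_res_avg ?cabs1 // expr1n.
have -> : 2^-1 *: (dyadic_res b k 1 + dyadic_res b k (-1)) - dyadic_res b k 1 =
    2^-1 *: (dyadic_res b k (-1) - dyadic_res b k 1).
  apply: (scalerI (_ : (2 : R[i]) != 0)); first by rewrite pnatr_eq0.
  rewrite scalerBr !scalerA mulfV ?pnatr_eq0 // !scale1r scaler_nat mulr2n.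
  by rewrite opprD addrA addrAC subrr add0r.
have := dyadic_res_lip b B Ub HB k (-1) 1; rewrite cabsN cabs1 => /(_ erefl erefl).
rewrite nrmZ cabsV -opprD cabsN -[1 + 1]/(2 : R[i]) cabs2; lra.
Qed.
Lemma tends_mul {u v x y} (B : R) : (forall n, nrm (v n) <= B) ->
  tends u x -> tends v y -> tends (fun n => u n * v n) (x * y).
Proof.
move=> vB ux vy; have B0 : 0 <= B by rewrite (le_trans (N_ge0 (v 0%N))).
apply: (tends_squeeze (B + nrm x) _ ux vy) => [|n]; first by rewrite addr_ge0.
have -> : u n * v n - x * y = (u n - x) * v n + x * (v n - y).
  by rewrite mulrBl mulrBr addrA subrK.
have := N_mul (u n - x) (v n); have := N_mul x (v n - y).
have := N_tri ((u n - x) * v n) (x * (v n - y)).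
have := vB n; have := N_ge0 (u n - x); have := N_ge0 (v n - y); have := N_ge0 x.
by move: (nrm _) (nrm _) (nrm _) (nrm _) => *; nra.
Qed.

Lemma idem_exp p n : p * p = p -> (0 < n)%N -> p ^+ n = p.
Proof.
move=> pp; elim: n => [//|[|n] IH _]; first by rewrite expr1.
by rewrite exprS IH.
Qed.

(** The map sending [x] to [p + x (1 - p)] keeps [x] on the corner of [1 - p] and is the identity on
    that of [p]. It is multiplicative on elements commuting with [p], and a commuting factor of a
    unit is a unit. *)
Lemma corner_unit p x y : p * p = p ->
  GRing.comm p x -> GRing.comm p y -> GRing.comm x y ->
  p + x * y * (1 - p) \is a GRing.unit -> p + x * (1 - p) \is a GRing.unit.
Proof.
move=> pp.
have qp : (1 - p) * p = 0 by rewrite mulrBl mul1r pp subrr.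
have pq : p * (1 - p) = 0 by rewrite mulrBr mulr1 pp subrr.
have qq : (1 - p) * (1 - p) = 1 - p by rewrite mulrBr mulr1 qp subr0.
have cornerM (u v : A) : GRing.comm p v ->
    (p + u * (1 - p)) * (p + v * (1 - p)) = p + u * v * (1 - p).
  move=> pv; have qv : (1 - p) * v = v * (1 - p).
    by rewrite mulrBl mulrBr mul1r mulr1 pv.
  move: (1 - p) qp pq qq qv => q qp pq qq qv.
  rewrite mulrDl !mulrDr pp [p * (v * _)]mulrA pv -[v * p * _]mulrA pq mulr0.
  rewrite addr0 -[u * _ * p]mulrA qp mulr0 add0r.
  by rewrite -[u * _ * _]mulrA [q * (_ * _)]mulrA qv -[v * _ * _]mulrA qq !mulrA.
move=> px py xy; rewrite -cornerM // unitrM_comm; first by case/andP.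
by rewrite /GRing.comm !cornerM // xy.
Qed.

(** * The Riesz projection as a limit of dyadic averages *)

Section RieszProjection.
Variables b p : A.
Hypothesis Ub : regular_circle b.
Hypothesis bp : tends (fun k => dyadic_res b k 1) p.

Let e k := dyadic_res b k 1.
Let f k := dyadic_res b k (-1).

Lemma riesz_comm x : GRing.comm x b -> GRing.comm x p.
Proof.
move=> xb; apply: tends_uniq (tends_mulr x bp).
apply: tends_ext (tends_mull x bp) => k; apply: commrV.
by apply: commrB; [exact: commr1 | rewrite scale1r; exact: commrX].
Qed.

(** Pass to the limit in [e k.+1 = e k * f k]; since [f k = 2 *: e k.+1 - e k], the factor [f k]
    also tends to [p]. *)
Lemma riesz_idem : p * p = p.
Proof.
have [B HB] := dyadic_res_bounded _ Ub.
have N1 : cabs (-1 : R[i]) = 1 by rewrite cabsN cabs1.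
have fE k : f k = 2 *: e k.+1 - e k.
  have := dyadic_res_avg _ Ub k 1 cabs1; rewrite expr1n -/(e k.+1) => ->.
  by rewrite scalerA mulfV ?pnatr_eq0 // scale1r addrAC subrr add0r.
have fp : tends f p.
  apply: (tends_squeeze 2 _ (tends_shift bp) bp) => // k /=; rewrite fE.
  have -> : 2 *: e k.+1 - e k - p = 2 *: (e k.+1 - p) - (e k - p).
    by rewrite scalerBr opprB [2 *: p]scaler_nat mulr2n opprD !addrA subrK addrAC.
  rewrite (le_trans (nrmB _ _)) // nrmZ.
  rewrite cabs2.
  by have := N_ge0 (e k - p); rewrite /e; lra.
have fB k : nrm (f k) <= B by exact: HB.
apply: tends_uniq (tends_shift bp); apply: tends_ext (tends_mul B fB bp fp) => k /=.
have U s : cabs s = 1 -> 1 - s *: b ^+ (2 ^ k) \is a GRing.unit by exact: dyadic_unit.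
have := dyadic_factor b k 1; rewrite expr1n /f /dyadic_res => ->.
rewrite -invrM ?U ?cabs1 //; congr (_^-1).
apply: commrB; first exact: commr1.
rewrite scale1r scaleN1r opprK; apply: commr_sym.
by apply: commrD; [exact: commr1 | exact: commr_refl].
Qed.

Let pb : GRing.comm p b. Proof. exact/commr_sym/riesz_comm/commr_refl. Qed.

Let pe k : GRing.comm p (e k).
Proof.
apply: commrV; apply: commrB; first exact: commr1.
by rewrite scale1r; exact: commrX.
Qed.

Let dyadic_resM k : b ^+ (2 ^ k) * e k = e k - 1.
Proof.
have U := dyadic_unit _ Ub k 1 (cabs1).
rewrite -[X in _ = _ - X](mulrV U) -[X in _ = X - _]mul1r -mulrBl.
by rewrite scale1r opprB addrC subrK.
Qed.

(* With z = b^N and e_N = (1 - z)^-1 we have z e_N = e_N - 1, so w = z e_N p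
   tends to p - p = 0, and z p = w - (z p) w. *)
Lemma riesz_pow_small : exists k, nrm ((b * p) ^+ (2 ^ k)) < 1.
Proof.
have /(_ (1 / 3)) [|k /(_ k (leqnn k)) small] := tends_mulr p bp; first by lra.
exists k; set z := b ^+ (2 ^ k); rewrite riesz_idem -/(e k) in small.
have -> : (b * p) ^+ (2 ^ k) = z * p.
  rewrite exprMn_comm; last exact/commr_sym/pb.
  by rewrite (idem_exp p _ riesz_idem) ?expn_gt0.
pose w := e k * p - p.
have wp : p * w = w by rewrite /w mulrBr mulrA pe -mulrA riesz_idem.
have wE : w = z * (e k * p) by rewrite mulrA dyadic_resM mulrBl mul1r.
have zpE : z * p = w - z * p * w.
  by rewrite -(mulrA z) wp {1}wE -mulrBr /w subKr.
have := nrmB w (z * p * w); rewrite -zpE; have := N_mul (z * p) w.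
rewrite -/w in small; have := N_ge0 (z * p); have := N_ge0 w; nra.
Qed.

(** With [N = 2^k], the product of [b] and [- b^(N-1) e_N] is [1 - e_N], and [e_N (1 - p)] tends to
    [p (1 - p) = 0]. So [b] divides a unit on the corner of [1 - p]. *)
Lemma riesz_compl_unit : p + b * (1 - p) \is a GRing.unit.
Proof.
have /(_ 1 ltr01) [k /(_ k (leqnn k)) small] := tends_mulr (1 - p) bp.
rewrite [p * _]mulrBr mulr1 riesz_idem subrr subr0 -/(e k) in small.
have U : 1 - e k * (1 - p) \is a GRing.unit by exact: neumann.
apply: (corner_unit _ _ (- (b ^+ (2 ^ k).-1 * e k)) riesz_idem) => //.
- by apply: commrN; apply: commrM => //; exact: commrX.
- apply: commrN; apply: commrM; first exact/commrX/commr_refl.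
  apply: commrV; apply: commrB; first exact: commr1.
  by rewrite scale1r; exact/commrX/commr_refl.
rewrite mulrN mulrA -exprS prednK ?expn_gt0 // dyadic_resM opprB mulrBl mul1r.
by rewrite addrA addrCA subrr addr0.
Qed.

End RieszProjection.

(** * From a projection to a Drazin inverse *)

Lemma drazin_of_projection a p : p * p = p -> GRing.comm a p ->
  p + a * (1 - p) \is a GRing.unit ->
  exists d, [/\ a * d = d * a, d * a * d = d & 1 - a * d = p].
Proof.
move=> pp ap Uu; set u := p + _ in Uu.
have qp : (1 - p) * p = 0 by rewrite mulrBl mul1r pp subrr.
have qq : (1 - p) * (1 - p) = 1 - p.
  by rewrite mulrBr mulr1 qp subr0.
have aq : GRing.comm a (1 - p) by apply: commrB => //; exact: commr1.
have pq : GRing.comm p (1 - p) by apply: commrB; [exact: commr1 | exact: commr_refl].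
have au : GRing.comm a u.
  by apply: commrD => //; apply: commrM => //; exact: commr_refl.
have pu : GRing.comm p u.
  by apply: commrD; [exact: commr_refl | apply: commrM => //; exact: commr_sym].
have qu : GRing.comm (1 - p) u.
  by apply: commr_sym; apply: commrB; [exact: commr1 | exact: commr_sym].
(* On the corner of [1 - p] the unit [u] acts as [a], so [u^-1 (1 - p)] inverts [a] there and
   vanishes on [p]. *)
have ad : a * (u^-1 * (1 - p)) = 1 - p.
  rewrite mulrA (commrV au) -mulrA.
  have -> : a * (1 - p) = u * (1 - p).
    by rewrite /u mulrDl pq qp add0r -mulrA qq.
  by rewrite mulrA mulVr // mul1r.
have ad' : a * (u^-1 * (1 - p)) = u^-1 * (1 - p) * a.
  by rewrite mulrA (commrV au) -!mulrA aq.
exists (u^-1 * (1 - p)); split=> //; last by rewrite ad subKr.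
by rewrite -ad' ad mulrA (commrV qu) -mulrA qq.
Qed.

Lemma regular_circleZ a (T r : R) : 0 <= T -> T < r ->
  (forall s, T < cabs s -> 1 - s *: a \is a GRing.unit) ->
  regular_circle (r%:C%C *: a).
Proof.
move=> T0 Tr Ua s s1; rewrite scalerA; apply: Ua.
by rewrite cabsM s1 mul1r cabs_real ger0_norm //; lra.
Qed.

Lemma riesz_quasinilpotent a p (T r : R) : 0 <= T -> T < r ->
  (forall s, T < cabs s -> 1 - s *: a \is a GRing.unit) ->
  tends (fun k => dyadic_res (r%:C%C *: a) k 1) p ->
  quasinilpotent (a * p).
Proof.
move=> T0 Tr Ua bp; have Ub := regular_circleZ _ _ _ T0 Tr Ua.
have r0 : r%:C%C != 0 :> R[i] by rewrite -cabs_eq0 cabs_real normr_eq0; lra.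
have pp := riesz_idem _ _ Ub bp.
have ap : GRing.comm p a.
  apply: commr_sym; apply: (riesz_comm _ _ bp).
  by rewrite /GRing.comm -scalerAl -scalerAr.
move=> l lP /=; apply: contrapT => /eqP l0; apply: lP.
have -> : l%:A - a * p = l *: (1 - l^-1 *: (a * p)).
  by rewrite scalerBr scalerA mulfV // scale1r.
rewrite scaler_unit ?unitfE //.
(* If [l^-1] exceeds [T] in modulus, [1 - l^-1 a] is a unit and restricts to the corner of [p].
   Otherwise [l^-1] is below [r] in modulus, and a power of [l^-1 a p] has norm less than 1 by
   [riesz_pow_small]. *)
have [big|small] := ltrP T (cabs l^-1).
  have -> : 1 - l^-1 *: (a * p) = (1 - p) + (1 - l^-1 *: a) * (1 - (1 - p)).
    by rewrite subKr mulrBl mul1r addrA subrK scalerAl.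
  apply: (corner_unit _ _ (1 - l^-1 *: a)^-1).
  - by rewrite mulrBr mulr1 mulrBl mul1r pp subrr subr0.
  - apply: commrB; first exact: commr1.
    rewrite /GRing.comm -scalerAr -scalerAl; congr (_ *: _).
    by rewrite mulrBl mulrBr mul1r mulr1 ap.
  - apply: commrV; apply: commrB; first exact: commr1.
    rewrite /GRing.comm -scalerAr -scalerAl; congr (_ *: _).
    by rewrite mulrBl mulrBr mul1r mulr1 ap.
  - exact/commrV/commr_refl.
  by rewrite mulrV ?Ua // mul1r subKr subrK unitr1.
have [k pk] := riesz_pow_small _ _ Ub bp.
apply: (unit_of_pow _ (2 ^ k)); apply: neumann.
have -> : l^-1 *: (a * p) = (l^-1 / r%:C%C) *: (r%:C%C *: a * p).
  by rewrite -scalerAl scalerA divfK.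
rewrite exprZn nrmZ (le_lt_trans _ pk) // ler_piMl // cabsX exprn_ile1 ?cabs_ge0 //.
rewrite cabsM [cabs (_ %:C%C)^-1]cabsV cabs_real ger0_norm ?ler_pdivrMr ?mul1r //; lra.
Qed.

(** Commuting idempotents satisfy [(x - y)^3 = x - y], and [1 - (x - y)^2] is a unit by the Neumann
    series. *)
Lemma idempotent_close x y : x * x = x -> y * y = y -> GRing.comm x y ->
  nrm (x - y) < 1 -> x = y.
Proof.
move=> xx yy xy d1; apply/eqP; rewrite -subr_eq0; apply/eqP.
have U : 1 - (x - y) ^+ 2 \is a GRing.unit.
  apply: neumann; rewrite (le_lt_trans (nrmX _ _)) //.
  by have := N_ge0 (x - y); nra.
apply: (mulIr U); rewrite mul0r mulrBr mulr1 -exprS.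
apply/eqP; rewrite subr_eq0; apply/eqP.
have yx : y * x = x * y by [].
have sq : (x - y) * (x - y) = x + y - (x * y + x * y).
  by rewrite mulrBl !mulrBr xx yy yx opprB addrACA -opprD.
have yxy : y * (x * y) = x * y by rewrite mulrA yx -mulrA yy.
have xxy : x * (x * y) = x * y by rewrite mulrA xx.
rewrite exprS expr2 sq mulrBl !mulrBr !mulrDr xx yy xxy yxy yx.
by rewrite [x * y + y]addrC !opprD !addrA !addrK opprK addrAC subrK.
Qed.
(** The proposition [D] is a switch: [True] demands the polynomial bound (Drazin), [False] only
    invertibility (g-Drazin). A single [n] serves as threshold and exponent. With [s = 1/l] this
    describes the resolvent of [a] near [l = 0]. *)
Definition resolvent_growth (D : Prop) a : Prop := exists n : nat, forall s,
  n%:R < cabs s -> 1 - s *: a \is a GRing.unit /\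
    (D -> nrm (1 - s *: a)^-1 <= cabs s ^+ n).

(** * Polynomial growth of the resolvent forces nilpotency *)

Section PolynomialGrowth.
Variables (a : A) (n : nat).
Hypothesis Ha : forall s, n%:R < cabs s -> 1 - s *: a \is a GRing.unit /\
  nrm (1 - s *: a)^-1 <= cabs s ^+ n.

Let Ra (t : R) := dyadic_res (t%:C%C *: a).

Let Ureg (t : R) : n%:R < t -> regular_circle (t%:C%C *: a).
Proof. by move=> nt; apply: (regular_circleZ _ n%:R) => // s /Ha[]. Qed.

Let res0_bound (t : R) s : n%:R < t -> cabs s = 1 ->
  nrm (1 - s *: (t%:C%C *: a))^-1 <= t ^+ n.
Proof.
move=> nt s1; have ct : cabs (s * t%:C%C) = t.
  by rewrite cabsM s1 mul1r cabs_real ger0_norm // (le_trans _ (ltW nt)).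
by rewrite scalerA; have [|_] := Ha (s * t%:C%C); rewrite ct.
Qed.

Let res_bound (t : R) k s : n%:R < t -> cabs s = 1 -> nrm (Ra t k s) <= t ^+ n.
Proof.
move=> nt; apply: (circle_avg_bound (Ra t) _ 0) => //.
  exact: dyadic_res_avg (Ureg _ nt).
by move=> z z1; rewrite /Ra /dyadic_res expn0 expr1 res0_bound.
Qed.

(** The difference of the averages at two radii again obeys the averaging rule, so the bound at
    [k = 0] from [sub_inv] persists in the limit. *)
Let riesz_lip (T t t' : R) p p' : n%:R < t -> n%:R < t' -> t <= T -> t' <= T ->
  tends (fun k => Ra t k 1) p -> tends (fun k => Ra t' k 1) p' ->
  nrm (p - p') <= T ^+ n * (`|t' - t| * nrm a) * T ^+ n.
Proof.
move=> nt nt' tT t'T tp tp'; have n0 : 0 <= n%:R :> R by [].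
apply: (tends_bound 0 (tends_sub tp tp')) => k _.
pose G k s := Ra t k s - Ra t' k s.
apply: (circle_avg_bound G _ 0) => //; last exact: cabs1.
  move=> j s s1; rewrite /G /Ra !dyadic_res_avg //; try exact: Ureg.
  by rewrite -scalerBr opprD addrACA.
move=> s s1; rewrite /G /Ra /dyadic_res expn0 !expr1 sub_inv; try exact: Ureg.
have -> : 1 - s *: (t'%:C%C *: a) - (1 - s *: (t%:C%C *: a)) =
    s *: ((t - t')%:C%C *: a).
  by rewrite opprB addrC addrA subrK rmorphB /= scalerBl scalerBr.
have pow r : n%:R < r -> r <= T -> r ^+ n <= T ^+ n.
  by move=> nr rT; apply: lerXn2r => //; rewrite nnegrE; lra.
rewrite (le_trans (N_mul _ _)) //; apply: ler_pM => //.
  rewrite (le_trans (N_mul _ _)) //; apply: ler_pM => //.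
    by rewrite (le_trans (res0_bound _ _ nt s1)) ?pow.
  by rewrite !nrmZ s1 mul1r cabs_real distrC.
by rewrite (le_trans (res0_bound _ _ nt' s1)) ?pow.
Qed.

(** The radii [r] and [t] are joined by steps of length at most [d]. Projections at neighbouring
    radii commute and are less than 1 apart, hence coincide. *)
Lemma riesz_indep (r t : R) p p' : n%:R < r -> r <= t ->
  tends (fun k => Ra r k 1) p -> tends (fun k => Ra t k 1) p' -> p' = p.
Proof.
move=> nr rt rp; have n0 : 0 <= n%:R :> R by [].
(* [C] is the Lipschitz constant of [riesz_lip] for radii up to [t]; [d] is chosen so that
   [C * d < 1], even for [C = 0]. *)
pose C := t ^+ n * nrm a * t ^+ n.
have C0 : 0 <= C by rewrite !mulr_ge0 // exprn_ge0 //; lra.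
pose d := (C + 1)^-1.
have d0 : 0 < d by rewrite invr_gt0; lra.
have Cd : C * d < 1 by rewrite ltr_pdivrMr ?mul1r; lra.
have chain (j : nat) : forall (u : R) q, r <= u -> u <= t -> u <= r + j%:R * d ->
    tends (fun k => Ra u k 1) q -> q = p.
  elim: j => [|j IH] u q ru ut uj uq.
    have {}uj : u = r by apply/eqP; rewrite eq_le ru; lra.
    by apply: tends_uniq rp; rewrite -uj.
  have [uj'|uj'] := lerP u (r + j%:R * d); first exact: IH uj' uq.
  (* One step back, but not below [r], so that the radius stays above the threshold [n]. *)
  pose u' := Num.max r (u - d).
  have [ru' du' u'u] : [/\ r <= u', u - d <= u' & u' <= u].
    by rewrite /u' !le_max !lexx orbT ge_max ru gerBl (ltW d0); split.
  have nu' : n%:R < u' by exact: lt_le_trans ru'.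
  have [q' uq'] := dyadic_res_tends _ (Ureg _ nu').
  have q'E : q' = p.
    apply: IH uq' => //; first by lra.
    rewrite /u' ge_max; apply/andP; split; first by rewrite lerDl mulr_ge0 // ltW.
    by rewrite -natr1 mulrDl mul1r in uj; lra.
  have nu : n%:R < u by exact: lt_le_trans ru.
  rewrite -q'E; apply: idempotent_close.
  - exact: riesz_idem (Ureg _ nu) uq.
  - exact: riesz_idem (Ureg _ nu') uq'.
  - apply: (riesz_comm _ _ uq'); rewrite /GRing.comm -scalerAl -scalerAr.
    congr (_ *: _); apply: commr_sym; apply: (riesz_comm _ _ uq).
    by rewrite /GRing.comm -scalerAl -scalerAr.
  apply: le_lt_trans (riesz_lip t _ _ _ _ nu nu' ut (le_trans u'u ut) uq uq') _.
  rewrite (_ : _ * _ = C * `|u' - u|); last by rewrite /C; ring.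
  apply: le_lt_trans Cd; rewrite ler_wpM2l // ler_norml; lra.
pose j := (Num.truncn ((t - r) / d)).+1.
apply: (chain j) => //; rewrite -lerBlDl -ler_pdivrMr //.
exact/ltW/truncnS_gt.
Qed.

(* Averaging z^-1 (1 - z a^N)^-1 over both square roots z of a large number
   isolates a^N (1 - z^2 a^(2N))^-1, whose size is at most |z|^-1 times the
   growth of the resolvent.  For N large this is O(1/t) on the circle of radius
   t, and so is its limit a^N p, where p does not depend on t. *)
Lemma riesz_nilpotent (r : R) p : n%:R < r -> 1 <= r ->
  tends (fun k => Ra r k 1) p -> a ^+ (2 ^ n.+1) * p = 0.
Proof.
move=> nr r1 rp; set N := (2 ^ n.+1)%N; set x := a ^+ N * p.
have bound t : r <= t -> t * nrm x <= 1.
  move=> rt; have nt : n%:R < t by exact: lt_le_trans rt.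
  have [p' tp'] := dyadic_res_tends _ (Ureg _ nt).
  have p'E := riesz_indep _ _ _ _ nr rt rp tp'; rewrite p'E in tp'.
  have t0 : 0 < t by lra.
  rewrite -ler_pdivlMl // mulr1.
  apply: (tends_bound n.+2 (tends_mull (a ^+ N) tp')) => k nk.
  apply: (circle_avg_bound (fun k s => a ^+ N * Ra t k s) _ n.+2 _ _ k 1 nk);
    last exact: cabs1.
    move=> i s s1; rewrite /Ra dyadic_res_avg //; last exact: Ureg.
    by rewrite -scalerAr mulrDr.
  move=> s; have [z zE] := complex_sqrt s; rewrite -zE => /cabs_sqr_eq1 z1.
  have zN1 : cabs (- z) = 1 by rewrite cabsN.
  set b := t%:C%C *: a.
  have U1 := dyadic_unit _ (Ureg _ nt) n.+1 _ z1.
  have U2 := dyadic_unit _ (Ureg _ nt) n.+1 _ zN1.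
  have key : (z *+ 2) *: (b ^+ N * Ra t n.+2 (z ^+ 2)) =
      Ra t n.+1 z - Ra t n.+1 (- z).
    rewrite /Ra /dyadic_res -[RHS]opprB sub_inv // -mulNr -mulrN opprB.
    rewrite dyadic_factor -/b -/N invrM //.
    have -> : 1 - - z *: b ^+ N - (1 - z *: b ^+ N) = (z *+ 2) *: b ^+ N.
      by rewrite scaleNr opprK opprB addrC addrA subrK -scalerDl mulr2n.
    rewrite -[in RHS]scalerAr -scalerAl; congr (_ *: _).
    have c s' : GRing.comm (b ^+ N) (1 - s' *: b ^+ N)^-1.
      apply: commrV; apply: commrB; first exact: commr1.
      by rewrite /GRing.comm -scalerAl -scalerAr.
    by rewrite mulrA c.
  have := nrmB (Ra t n.+1 z) (Ra t n.+1 (- z)); rewrite -key nrmZ -mulr_natl cabsM z1 mulr1.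
  rewrite cabs2.
  have := res_bound _ n.+1 _ nt z1; have := res_bound _ n.+1 _ nt zN1.
  rewrite /b exprZn -scalerAl nrmZ cabsX cabs_real (ger0_norm (ltW t0)).
  set y := nrm (_ * _) => h1 h2 h3.
  have {}h : t ^+ N * y <= t ^+ n by lra.
  rewrite -[t^-1]mulr1 ler_pdivlMl //.
  (* The exponent exceeds the growth rate [n], which leaves a spare factor [t]. *)
  have Nn : (n < N)%N by rewrite ltnW // ltn_expl.
  have tn0 : 0 < t ^+ n by rewrite exprn_gt0.
  rewrite -(ler_pM2l tn0) mulr1 mulrA; apply: le_trans h.
  rewrite ler_wpM2r ?N_ge0 // -exprSr ler_weXn2l //; lra.
apply: (nrm_eq0 hnrm); apply/eqP; rewrite eq_le N_ge0 andbT leNgt; apply/negP => x0.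
(* At this radius the bound would give [2 <= 1]. *)
have := bound (r + 2 / nrm x); rewrite lerDl divr_ge0 ?(ltW x0) // => /(_ isT).
rewrite mulrDl divfK ?gt_eqF //; have : 0 <= r * nrm x by rewrite mulr_ge0 //; lra.
lra.
Qed.

End PolynomialGrowth.

(** * From resolvent growth to Drazin and g-Drazin inverses *)

Lemma riesz_drazin a (T r : R) : 0 <= T -> T < r ->
  (forall s, T < cabs s -> 1 - s *: a \is a GRing.unit) ->
  exists p d, [/\ tends (fun k => dyadic_res (r%:C%C *: a) k 1) p,
    a * d = d * a, d * a * d = d & 1 - a * d = p].
Proof.
move=> T0 Tr Ua; have Ub := regular_circleZ _ _ _ T0 Tr Ua.
have [p bp] := dyadic_res_tends _ Ub.
have ap : GRing.comm a p.
  by apply: (riesz_comm _ _ bp); rewrite /GRing.comm -scalerAl -scalerAr.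
have pp := riesz_idem _ _ Ub bp.
have scal x : GRing.comm x (r%:C%C)%:A.
  by rewrite /GRing.comm -scalerAr -scalerAl mulr1 mul1r.
have [|d [ad dad pE]] := drazin_of_projection _ _ pp ap; last by exists p, d.
(* The scalar [r] is the cofactor that turns [a] into [b = r a], to which [riesz_compl_unit]
   applies. *)
apply: (corner_unit _ _ (r%:C%C)%:A pp) => //.
by rewrite -scalerAr mulr1; exact: riesz_compl_unit Ub bp.
Qed.

Lemma gdrazin_of_growth a : resolvent_growth False a -> gdrazin_invertible a.
Proof.
case=> n Ha; have Ua s : n%:R < cabs s -> 1 - s *: a \is a GRing.unit by case/Ha.
have nr : n%:R < n%:R + 1 :> R by lra.
have [p [d [bp ad dad pE]]] := riesz_drazin _ _ _ (ler0n _ n) nr Ua.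
exists d; split=> //; split=> //; rewrite pE.
exact: riesz_quasinilpotent (ler0n _ n) nr Ua bp.
Qed.

Lemma drazin_of_growth a : resolvent_growth True a -> drazin_invertible a.
Proof.
case=> n Ha; have Ha' s : n%:R < cabs s -> 1 - s *: a \is a GRing.unit /\
  nrm (1 - s *: a)^-1 <= cabs s ^+ n by case/Ha => ? /(_ I).
have Ua s : n%:R < cabs s -> 1 - s *: a \is a GRing.unit by case/Ha.
have nr : n%:R < n%:R + 1 :> R by lra.
have [p [d [bp ad dad pE]]] := riesz_drazin _ _ _ (ler0n _ n) nr Ua.
exists d; split=> //; split=> //; rewrite pE; exists (2 ^ n.+1)%N.
rewrite exprMn_comm; last first.
  by rewrite -pE; apply: commrB; [exact: commr1 | rewrite /GRing.comm -mulrA ad].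
rewrite (idem_exp p) ?expn_gt0 //; last first.
  by have Ub := regular_circleZ _ _ _ (ler0n _ n) nr Ua; exact: riesz_idem Ub bp.
by apply: (riesz_nilpotent _ _ Ha' _ _ nr _ bp); rewrite lerDr.
Qed.

(** * Polynomially bounded functions of a large scalar *)

Definition eventually_large (P : R[i] -> Prop) : Prop :=
  exists n : nat, forall s, n%:R < cabs s -> P s.

Lemma ev_and P Q : eventually_large P -> eventually_large Q ->
  eventually_large (fun s => P s /\ Q s).
Proof.
move=> [n HP] [m HQ]; exists (maxn n m) => s; rewrite natr_max gt_max => /andP[ns ms].
by split; [exact: HP | exact: HQ].
Qed.

Lemma ev_mono P Q : (forall s, P s -> Q s) -> eventually_large P -> eventually_large Q.
Proof. by move=> PQ [n HP]; exists n => s /HP/PQ. Qed.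

Lemma ev_ge (t : R) : eventually_large (fun s => t <= cabs s).
Proof.
exists (Num.truncn t).+1 => s /ltW; apply: le_trans.
exact/ltW/truncnS_gt.
Qed.

(** A constant factor is absorbed into the exponent once [cabs s] is large. *)
Definition poly_bounded (F : R[i] -> A) : Prop :=
  exists m, eventually_large (fun s => nrm (F s) <= cabs s ^+ m).

Lemma pb_ext {F G} : eventually_large (fun s => F s = G s) ->
  poly_bounded F -> poly_bounded G.
Proof.
move=> FG [m Fm]; exists m; apply: ev_mono (ev_and _ _ FG Fm) => s.
by case=> ->.
Qed.

Lemma pb_bounded F (B : R) : eventually_large (fun s => nrm (F s) <= B) -> poly_bounded F.
Proof.
move=> FB; exists 1%N; apply: ev_mono (ev_and _ _ FB (ev_ge B)) => s [].
by rewrite expr1; exact: le_trans.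
Qed.

Lemma pb_const x : poly_bounded (fun=> x).
Proof. by apply: (pb_bounded _ (nrm x)); exists 0%N. Qed.

Lemma pb_mul F G : poly_bounded F -> poly_bounded G -> poly_bounded (fun s => F s * G s).
Proof.
move=> [n Fn] [m Gm]; exists (n + m)%N; apply: ev_mono (ev_and _ _ Fn Gm) => s [h1 h2].
by rewrite exprD (le_trans (N_mul _ _)) // ler_pM.
Qed.

Lemma pb_scale F : poly_bounded F -> poly_bounded (fun s => s *: F s).
Proof.
move=> [n Fn]; exists n.+1; apply: ev_mono Fn => s h.
by rewrite nrmZ exprS ler_wpM2l // cabs_ge0.
Qed.

Lemma pb_add F G : poly_bounded F -> poly_bounded G -> poly_bounded (fun s => F s + G s).
Proof.
move=> [n Fn] [m Gm]; exists (n + m).+1.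
apply: ev_mono (ev_and _ _ (ev_and _ _ Fn Gm) (ev_ge 2)) => s [[h1 h2] s2].
have s1 : 1 <= cabs s by lra.
have e1 : cabs s ^+ n <= cabs s ^+ (n + m) by rewrite ler_weXn2l // leq_addr.
have e2 : cabs s ^+ m <= cabs s ^+ (n + m) by rewrite ler_weXn2l // leq_addl.
have := N_tri (F s) (G s); rewrite exprS.
have : 1 <= cabs s ^+ (n + m) by rewrite exprn_ege1.
nra.
Qed.

Lemma pb_opp F : poly_bounded F -> poly_bounded (fun s => - F s).
Proof. by move=> [m Fm]; exists m; apply: ev_mono Fm => s; rewrite nrmN. Qed.

Lemma pb_linear x : poly_bounded (fun s => 1 - s *: x).
Proof. by apply: pb_add; [exact: pb_const | exact/pb_opp/pb_scale/pb_const]. Qed.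

(** * Resolvent growth of Drazin and g-Drazin invertible elements *)

Lemma growthP D a : resolvent_growth D a <->
  eventually_large (fun s => 1 - s *: a \is a GRing.unit) /\
  (D -> poly_bounded (fun s => (1 - s *: a)^-1)).
Proof.
split=> [[n H]|[U B]].
  by split=> [|d]; [exists n => s /H[] | exists n, n => s /H[_]; exact].
have [d|nd] := pselect D; last first.
  by case: U => n U; exists n => s /U.
have [m Bm] := B d; have [n H] := ev_and _ _ U Bm.
(* The 1 ensures [cabs s > 1], so that raising the exponent weakens the bound. *)
exists (maxn 1 (maxn n m)) => s; rewrite !natr_max !gt_max => /and3P[s1 ns _].
have [Us Bs] := H _ ns; split=> // _; apply: le_trans Bs _.
by rewrite ler_weXn2l ?ltW // !leq_max leqnn !orbT.
Qed.

(** With [q = a p] and [e = a b], [1 - s a] splits as [(1 - s q) (1 - s a e)]. The second factor has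
    a bounded inverse for large [s]; the first is a unit, with inverse polynomial in [s] when [q] is
    nilpotent. *)
Lemma growth_of_inverse D a b : a * b = b * a -> b * a * b = b ->
  (forall s, 1 - s *: (a * (1 - a * b)) \is a GRing.unit) ->
  (D -> exists n, (a * (1 - a * b)) ^+ n = 0) -> resolvent_growth D a.
Proof.
move=> ab bab Uq nilq; set p := 1 - a * b in Uq nilq; set q := a * p in Uq nilq.
have bp : b * p = 0 by rewrite /p mulrBr mulr1 mulrA bab subrr.
have abb : a * b * b = b by rewrite ab.
have pb0 : p * b = 0 by rewrite /p mulrBl mul1r abb subrr.
have ee : a * b * (a * b) = a * b by rewrite mulrA -(mulrA a b a) -(mulrA a) bab.
pose e := a * b; have ae : GRing.comm a e by rewrite /GRing.comm /e -mulrA ab.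
have pe : p * e = 0 by rewrite /p -/e mulrBl mul1r ee subrr.
have ep : e * p = 0 by rewrite /p -/e mulrBr mulr1 ee subrr.
have pDe : p + e = 1 by rewrite /p subrK.
have factor s : 1 - s *: a = (1 - s *: q) * (1 - s *: (a * e)).
  have qae : q * (a * e) = 0 by rewrite ae /q -mulrA [p * _]mulrA pe mul0r mulr0.
  rewrite mulrBl mul1r mulrBr mulr1 -scalerAl -scalerAr qae !scaler0 subr0.
  by rewrite -addrA -opprD -scalerDr -mulrDr [e + _]addrC pDe mulr1.
(* On the corner of [e], [1 - s a = - s a (1 - s^-1 b)] and [b] inverts [a]; on that of [p] the
   inverse is the identity. *)
pose v s := p - s^-1 *: b.
have inv_r s : s != 0 -> (1 - s *: (a * e)) * v s = 1 - s^-1 *: b.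
  move=> s0; have aep : a * e * p = 0 by rewrite -mulrA ep mulr0.
  have aeb : a * e * b = e by rewrite -mulrA /e abb.
  rewrite mulrBl mul1r mulrBr -!scalerAl -scalerAr aep aeb scaler0 sub0r opprK.
  by rewrite scalerA mulfV // scale1r addrAC pDe.
have inv_l s : s != 0 -> v s * (1 - s *: (a * e)) = 1 - s^-1 *: b.
  move=> s0; have pae : p * (a * e) = 0 by rewrite ae mulrA pe mul0r.
  have bae : b * (a * e) = e by rewrite mulrA -ab -/e ee.
  rewrite mulrBr mulr1 mulrBl -!scalerAr -scalerAl pae bae scaler0 sub0r opprK.
  by rewrite scalerA mulfV // scale1r addrAC pDe.
pose V s := (1 - s^-1 *: b)^-1.
have evb : eventually_large (fun s => s != 0 /\ nrm (s^-1 *: b) <= 1 / 2).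
  apply: ev_mono (ev_ge (2 * nrm b + 1)) => s hs.
  have s0 : 0 < cabs s by have := N_ge0 b; lra.
  split; first by rewrite -cabs_gt0.
  rewrite nrmZ cabsV ler_pdivrMl //; lra.
have UV s : s != 0 /\ nrm (s^-1 *: b) <= 1 / 2 -> 1 - s^-1 *: b \is a GRing.unit.
  by move=> [_ h]; apply: neumann; lra.
have Uae s : s != 0 /\ nrm (s^-1 *: b) <= 1 / 2 ->
    1 - s *: (a * e) \is a GRing.unit /\ (1 - s *: (a * e))^-1 = v s * V s.
  move=> hs; have [s0 _] := hs; have U := UV _ hs.
  have : (1 - s *: (a * e)) * v s \is a GRing.unit by rewrite inv_r.
  rewrite unitrM_comm; last by rewrite /GRing.comm inv_r // inv_l.
  case/andP=> U1 U2; split=> //; apply: (mulrI U1).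
  by rewrite mulrV // mulrA inv_r // mulrV.
apply/growthP; split.
  apply: ev_mono evb => s /Uae[U _].
  by rewrite factor unitrMl.
case/nilq=> n qn0; have pbU : poly_bounded (fun s => (1 - s *: q)^-1).
  (* Descent from [q^n = 0] through [q^i (1 - s q)^-1 = q^i + s q^(i+1) (1 - s q)^-1]. *)
  have : forall j i, (i + j = n)%N -> poly_bounded (fun s => q ^+ i * (1 - s *: q)^-1).
    elim=> [|j IH] i; rewrite ?addn0.
      move=> ->; apply: pb_ext (pb_const 0); exists 0%N => s _.
      by rewrite qn0 mul0r.
    rewrite addnS -addSn => /IH h.
    apply: pb_ext (pb_add _ _ (pb_const (q ^+ i)) (pb_scale _ h)).
    exists 0%N => s _; have := mulrV (Uq s); rewrite mulrBl mul1r.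
    move/eqP; rewrite subr_eq => /eqP {2}->.
    by rewrite mulrDr mulr1 -scalerAl -scalerAr mulrA exprSr.
  by move/(_ n 0%N (add0n n)); apply: pb_ext; exists 0%N => s _; rewrite expr0 mul1r.
apply: pb_ext (pb_mul _ _ (pb_bounded (fun s => v s * V s) ((nrm p + 1) * 2) _) pbU).
  apply: ev_mono evb => s /Uae[U <-].
  by rewrite factor invrM.
apply: ev_mono evb => s hs; rewrite (le_trans (N_mul _ _)) // ler_pM //.
  by rewrite (le_trans (nrmB _ _)) // lerD2l; case: hs => _; lra.
have := nrm_inv_near 1 (1 - s^-1 *: b); rewrite unitr1 invr1 N_one subKr !mulr1.
by apply=> //; [exact: UV | case: hs].
Qed.

Lemma growth_of_gdrazin a : gdrazin_invertible a -> resolvent_growth False a.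
Proof.
case=> b [ab [bab qn]]; apply: (growth_of_inverse _ _ b ab bab) => // s.
have [->|s0] := eqVneq s 0; first by rewrite scale0r subr0 unitr1.
set q := a * _ in qn *.
have -> : 1 - s *: q = s *: (s^-1%:A - q) by rewrite scalerBr scalerA mulfV // scale1r.
rewrite scaler_unit ?unitfE //; apply: contrapT => nU.
by have := qn s^-1 nU => /= /eqP; rewrite invr_eq0 (negbTE s0).
Qed.

Lemma growth_of_drazin a : drazin_invertible a -> resolvent_growth True a.
Proof.
case=> b [ab [bab [n qn]]]; apply: (growth_of_inverse _ _ b ab bab); last by exists n.
move=> s; apply: (unit_of_pow _ n.+1).
by rewrite exprZn [(_ * _) ^+ _]exprS qn mulr0 scaler0 subr0 unitr1.
Qed.
(* If al1 or be vanishes, so do the thresholds 2 / |al1| and 3 / |be| in the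
   proof, by the convention x / 0 = 0. *)
Lemma cubic_estimates (al1 al2 be : R[i]) : exists L : R, 0 < L /\
  eventually_large (fun s =>
    let nu := s * (al2 - s + be * s ^+ 2) / (1 - al1 * s) in
    [/\ 1 <= cabs s, 1 <= cabs (1 - al1 * s), cabs (1 - al1 * s) <= cabs s ^+ 2,
        cabs s <= L * cabs nu & cabs nu <= cabs s ^+ 4]).
Proof.
have A1 := cabs_ge0 al1; have A2 := cabs_ge0 al2; have B := cabs_ge0 be.
(* From [cabs (1 - al1 s) <= (1 + cabs al1) * cabs s] and
   [cabs s <= 2 * cabs (al2 - s + be s^2)]. *)
exists (2 * (1 + cabs al1)); split; first by lra.
pose T := 2 / cabs al1 + 3 / cabs be + cabs al1 + 2 * cabs al2 + cabs be + 2.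
apply: ev_mono (ev_ge T) => s; rewrite /T.
have q1 : 0 <= 2 / cabs al1 by rewrite divr_ge0.
have q2 : 0 <= 3 / cabs be by rewrite divr_ge0.
move=> hs; have s1 : 1 <= cabs s by lra.
have c_ge : 1 <= cabs (1 - al1 * s).
  have [->|nz] := eqVneq al1 0; first by rewrite mul0r subr0 cabs1.
  have pos : 0 < cabs al1 by rewrite cabs_gt0.
  have : 2 / cabs al1 <= cabs s by lra.
  rewrite ler_pdivrMr //.
  by have := cabs_lb (- (al1 * s)) 1; rewrite [- _ + 1]addrC cabsN cabsM cabs1; lra.
have c_le : cabs (1 - al1 * s) <= 1 + cabs al1 * cabs s.
  by have := cabsD 1 (- (al1 * s)); rewrite cabsN cabsM cabs1.
have num_le : cabs (al2 - s + be * s ^+ 2) <=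
    cabs al2 + cabs s + cabs be * cabs s ^+ 2.
  have := cabsD (al2 - s) (be * s ^+ 2); have := cabsD al2 (- s).
  by rewrite cabsN cabsM cabsX; lra.
have num_ge : cabs s <= 2 * cabs (al2 - s + be * s ^+ 2).
  have [->|nz] := eqVneq be 0.
    rewrite mul0r addr0; have := cabs_lb (- s) al2.
    by rewrite cabsN [- s + _]addrC; lra.
  have pos : 0 < cabs be by rewrite cabs_gt0.
  have : 3 / cabs be <= cabs s by lra.
  rewrite ler_pdivrMr // => h3.
  have := cabs_lb (be * s ^+ 2) (al2 - s); rewrite [_ + (_ - _)]addrC cabsM cabsX.
  have := cabsD al2 (- s); rewrite cabsN => h4 h5.
  have : 3 * cabs s <= cabs be * cabs s ^+ 2 by nra.
  lra.
have c_pos : 0 < cabs (1 - al1 * s) by lra.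
move: (al2 - s + be * s ^+ 2) (1 - al1 * s) num_le num_ge c_ge c_le c_pos => w c.
rewrite /= !cabsM cabsV; move: (cabs w) (cabs c) (cabs s) (cabs al1) (cabs al2) (cabs be)
  A1 A2 B (2 / _) (3 / _) q1 q2 hs s1.
move=> n m t a a2 b a0 a20 b0 q1 q2 q10 q20 hs t1 nle nge m1 mle m0.
have t2 : t <= t ^+ 2 by nra.
split=> //.
- nra.
- rewrite mulrA ler_pdivlMr //.
  have h1 : t * m <= t * (1 + a * t) by rewrite ler_pM2l //; lra.
  have h2 : t * (1 + a * t) <= (1 + a) * (t * t) by nra.
  have h3 : (1 + a) * (t * t) <= (1 + a) * (t * (2 * n)).
    by rewrite ler_wpM2l ?ler_wpM2l //; lra.
  lra.
rewrite ler_pdivrMr //; have n3 : n <= t ^+ 3.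
  have h1 : a2 + t + b * t ^+ 2 <= (a2 + 1 + b) * t ^+ 2 by nra.
  have h2 : (a2 + 1 + b) * t ^+ 2 <= t ^+ 3.
    by rewrite [t ^+ 3]exprS ler_wpM2r ?sqr_ge0 //; lra.
  lra.
have h1 : t * n <= t ^+ 4 by rewrite [t ^+ 4]exprS ler_wpM2l //; lra.
rewrite (le_trans h1) // ler_peMr // exprn_ge0; lra.
Qed.

(** Each inverse is written with the inverse of the whole product and the other factors themselves,
    which are linear in [s] in the application; so its growth is that of the product's inverse. *)
Lemma unit_factors x y z : x * y * z \is a GRing.unit ->
  [/\ y \is a GRing.unit -> z \is a GRing.unit ->
        x \is a GRing.unit /\ x^-1 = y * z * (x * y * z)^-1,
      x \is a GRing.unit -> z \is a GRing.unit ->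
        y \is a GRing.unit /\ y^-1 = z * (x * y * z)^-1 * x &
      x \is a GRing.unit -> y \is a GRing.unit ->
        z \is a GRing.unit /\ z^-1 = (x * y * z)^-1 * x * y].
Proof.
move=> U; have inverse (x' : A) : x' \is a GRing.unit -> forall y', x' * y' = 1 -> x'^-1 = y'.
  by move=> Ux' y' xy; apply: (mulrI Ux'); rewrite xy mulrV.
split=> U1 U2.
- have Ux : x \is a GRing.unit by move: U; rewrite !unitrMl.
  by split=> //; apply: inverse => //; rewrite !mulrA mulrV.
- have Uy : y \is a GRing.unit by move: U; rewrite unitrMl // unitrMr.
  split=> //; apply: inverse => //; apply: (mulrI U1).
  by rewrite !mulrA mulrV // mul1r mulr1.
have Uz : z \is a GRing.unit by move: U; rewrite unitrMr // unitrMl.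
split=> //; apply: inverse => //; apply: (mulrI (_ : x * y \is a GRing.unit)).
  by rewrite unitrMl.
by rewrite !mulrA mulrV // mul1r mulr1.
Qed.

(** * Transfer of resolvent growth along the cubic identity *)

Section CubicRelations.
Variables (x1 x2 x3 : A) (al1 al2 be : R[i]).
Let y := x1 * x2 + x1 * x3 + x2 * x3.
Hypothesis sumE : x1 + x2 + x3 = al1%:A + al2 *: y.
Hypothesis prodE : x1 * x2 * x3 = be *: y.

Let W s := (1 - s *: x1) * (1 - s *: x2) * (1 - s *: x3).
Let c s : R[i] := 1 - al1 * s.
Let num s : R[i] := s * (al2 - s + be * s ^+ 2).

(** Expanding without commuting any factors gives exactly the ordered products occurring in [sumE],
    [prodE] and [y]. *)
Lemma resolvent_cubic s : W s = (c s)%:A - num s *: y.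
Proof.
have expand (u1 u2 u3 : A) : (1 + u1) * (1 + u2) * (1 + u3) =
    1 + (u1 + u2 + u3) + (u1 * u2 + u1 * u3 + u2 * u3) + u1 * u2 * u3.
  rewrite [(1 + u1) * _]mulrDl mul1r [u1 * _]mulrDr mulr1 mulrDr mulr1 !mulrDl mul1r.
  by rewrite !addrA [LHS](ACl (1*3*2*5*4*7*6*8))%AC.
have -> : W s = (1 + - s *: x1) * (1 + - s *: x2) * (1 + - s *: x3).
  by rewrite /W !scaleNr.
rewrite expand -!scalerAl -!scalerAr -!scalerAl !scalerA.
rewrite -!scalerDr -/y sumE prodE scalerDr !scalerA.
have -> : num s = s * al2 - s ^+ 2 + s ^+ 3 * be by rewrite /num; ring.
rewrite /c scalerBl scale1r scalerDl scalerBl [al1 * s]mulrC !opprD opprK.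
have -> : - s * - s * - s * be = - (s ^+ 3 * be) by ring.
by rewrite mulrNN -expr2 !mulNr !scaleNr !addrA.
Qed.

Lemma resolvent_cubic_factor s : c s != 0 -> W s = c s *: (1 - (num s / c s) *: y).
Proof.
by move=> c0; rewrite resolvent_cubic scalerBr scalerA mulrC divfK.
Qed.

Lemma growth_product D : resolvent_growth D y ->
  eventually_large (fun s => W s \is a GRing.unit) /\
  (D -> poly_bounded (fun s => (W s)^-1)).
Proof.
case=> n Hy; have [L [L0 est]] := cubic_estimates al1 al2 be.
have ev : eventually_large (fun s => [/\ 1 <= cabs s, 1 <= cabs (c s), c s != 0,
    cabs (num s / c s) <= cabs s ^+ 4 & n%:R < cabs (num s / c s)]).
  (* As [cabs s <= L * cabs nu], taking [cabs s >= L (n + 1)] pushes [nu] beyond the threshold of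
     [y]. *)
  apply: ev_mono (ev_and _ _ est (ev_ge (L * (n%:R + 1)))) => s [[s1 c1 _ sL nu4] sn].
  split=> //; first by rewrite -cabs_gt0; lra.
  have : L * (n%:R + 1) <= L * cabs (num s / c s) by exact: le_trans sL.
  by rewrite ler_pM2l //; lra.
split; first by apply: ev_mono ev => s [_ _ c0 _ /Hy[U _]];
  rewrite resolvent_cubic_factor // scaler_unit ?unitfE.
(* [cabs nu <= cabs s ^+ 4] accounts for the exponent; the scalar [(c s)^-1] has modulus at most
   1. *)
move=> d; exists (4 * n)%N; apply: ev_mono ev => s [s1 c1 c0 nu4 /Hy[U /(_ d) B]].
rewrite resolvent_cubic_factor // invrZ ?unitfE // nrmZ cabsV exprM.
apply: (le_trans (_ : _ <= nrm (1 - (num s / c s) *: y)^-1)).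
  by rewrite ler_piMl ?N_ge0 // invf_le1 //; lra.
by rewrite (le_trans B) // lerXn2r ?nnegrE ?exprn_ge0 ?cabs_ge0.
Qed.

Lemma growth_x1 D : resolvent_growth D y -> resolvent_growth D x2 ->
  resolvent_growth D x3 -> resolvent_growth D x1.
Proof.
move=> /growth_product[U B] /growthP[U2 B2] /growthP[U3 B3].
have ev := ev_and _ _ U (ev_and _ _ U2 U3).
apply/growthP; split=> [|d].
  by apply: ev_mono ev => s [/unit_factors[h _ _] [u2 u3]]; have [] := h u2 u3.
apply: pb_ext (pb_mul _ _ (pb_mul _ _ (pb_linear x2) (pb_linear x3)) (B d)).
by apply: ev_mono ev => s [/unit_factors[h _ _] [u2 u3]]; have [] := h u2 u3.
Qed.

Lemma growth_x2 D : resolvent_growth D y -> resolvent_growth D x1 ->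
  resolvent_growth D x3 -> resolvent_growth D x2.
Proof.
move=> /growth_product[U B] /growthP[U1 B1] /growthP[U3 B3].
have ev := ev_and _ _ U (ev_and _ _ U1 U3).
apply/growthP; split=> [|d].
  by apply: ev_mono ev => s [/unit_factors[_ h _] [u1 u3]]; have [] := h u1 u3.
apply: pb_ext (pb_mul _ _ (pb_mul _ _ (pb_linear x3) (B d)) (pb_linear x1)).
by apply: ev_mono ev => s [/unit_factors[_ h _] [u1 u3]]; have [] := h u1 u3.
Qed.

Lemma growth_x3 D : resolvent_growth D y -> resolvent_growth D x1 ->
  resolvent_growth D x2 -> resolvent_growth D x3.
Proof.
move=> /growth_product[U B] /growthP[U1 B1] /growthP[U2 B2].
have ev := ev_and _ _ U (ev_and _ _ U1 U2).
apply/growthP; split=> [|d].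
  by apply: ev_mono ev => s [/unit_factors[_ _ h] [u1 u2]]; have [] := h u1 u2.
apply: pb_ext (pb_mul _ _ (pb_mul _ _ (B d) (pb_linear x1)) (pb_linear x2)).
by apply: ev_mono ev => s [/unit_factors[_ _ h] [u1 u2]]; have [] := h u1 u2.
Qed.

Lemma growth_y D : resolvent_growth D x1 -> resolvent_growth D x2 ->
  resolvent_growth D x3 -> resolvent_growth D y.
Proof.
move=> /growthP[U1 B1] /growthP[U2 B2] /growthP[U3 B3].
have [L [L0 est]] := cubic_estimates al1 al2 be.
have EU : eventually_large (fun s => W s \is a GRing.unit).
  apply: ev_mono (ev_and _ _ U1 (ev_and _ _ U2 U3)) => s [u1 [u2 u3]].
  by rewrite /W unitrMl // unitrMl.
have EB (d : D) : poly_bounded (fun s => (W s)^-1).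
  apply: pb_ext (pb_mul _ _ (B3 d) (pb_mul _ _ (B2 d) (B1 d))).
  apply: ev_mono (ev_and _ _ U1 (ev_and _ _ U2 U3)) => s [u1 [u2 u3]].
  by rewrite /W invrM ?invrM // unitrMl.
(* Changes variable from [s] to [nu]: every large [nu] is attained at a large [s], where [P]
   holds. *)
have lift (P : R[i] -> Prop) : eventually_large P ->
    eventually_large (fun nu => exists s,
      [/\ P s, c s != 0, nu = num s / c s, cabs (c s) <= cabs s ^+ 2 &
          cabs s <= L * cabs nu]).
  move=> EP; have [N HN] := ev_and _ _ EP est.
  apply: ev_mono (ev_ge ((N%:R + 1) ^+ 3 * (1 + cabs be) + 1)) => nu hnu.
  have N0 : 0 <= N%:R :> R by [].
  have [||s [Ns sE]] := large_cubic_root al1 al2 be nu (N%:R + 1); try lra.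
  have [|Ps [s1 c1 c2 sL _]] := HN s; first by lra.
  have c0 : c s != 0 by rewrite -cabs_gt0 /c; lra.
  have nuE : nu = num s / c s by rewrite /num sE mulfK.
  by exists s; split=> //; rewrite {1}nuE.
have inverse s : c s != 0 -> W s \is a GRing.unit ->
    1 - (num s / c s) *: y \is a GRing.unit /\
    (1 - (num s / c s) *: y)^-1 = c s *: (W s)^-1.
  move=> c0; rewrite resolvent_cubic_factor // scaler_unit ?unitfE // => U; split=> //.
  by rewrite invrZ ?unitfE // scalerA mulfV // scale1r.
apply/growthP; split.
  by apply: ev_mono (lift _ EU) => nu [s [Us c0 -> _ _]]; have [] := inverse s c0 Us.
(* The bounds on [c s] and [(W s)^-1] multiply to [cabs s ^+ (m + 2)], and
   [cabs s <= L * cabs nu <= cabs nu ^+ 2] once [cabs nu >= L]. *)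
case/EB=> m EBm; exists (2 * (m + 2))%N.
apply: ev_mono (ev_and _ _ (lift _ (ev_and _ _ EU EBm)) (ev_ge L)).
move=> nu [[s [[Us Bs] c0 nuE c2 sL]] nuL].
rewrite nuE; have [_ ->] := inverse s c0 Us; rewrite -nuE nrmZ exprM.
apply: le_trans (_ : cabs s ^+ (m + 2) <= _).
  by rewrite addnC exprD ler_pM ?cabs_ge0.
rewrite lerXn2r ?nnegrE ?exprn_ge0 ?cabs_ge0 // (le_trans sL) // expr2.
by rewrite ler_wpM2r // cabs_ge0.
Qed.

End CubicRelations.

End BanachAlgebra.

Theorem theorem2p3 (R : realType) (A : unitAlgType R[i])
    (nrm : A -> R) (hnrm : banach_algebra_norm nrm) (x1 x2 x3 : A)
    (alpha1 alpha2 beta : R[i]) :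
  x1 + x2 + x3 = alpha1%:A + alpha2 *: (x1 * x2 + x1 * x3 + x2 * x3) ->
  x1 * x2 * x3 = beta *: (x1 * x2 + x1 * x3 + x2 * x3) ->
  any_three_imply_fourth (@drazin_invertible R A) x1 x2 x3
    (x1 * x2 + x1 * x3 + x2 * x3) /\
  any_three_imply_fourth (@gdrazin_invertible R A) x1 x2 x3
    (x1 * x2 + x1 * x3 + x2 * x3).
Proof.
move=> sumE prodE.
(* Both halves are one statement about [resolvent_growth], with [D] set to [True] or [False]. *)
have transfer (D : Prop) (P : A -> Prop) :
    (forall a, P a <-> resolvent_growth nrm D a) ->
    any_three_imply_fourth P x1 x2 x3 (x1 * x2 + x1 * x3 + x2 * x3).
  move=> PE; split; case=> /PE h1 [/PE h2 /PE h3]; apply/PE.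
  - exact: growth_x1 hnrm _ _ _ _ _ _ sumE prodE _ h3 h1 h2.
  - exact: growth_x2 hnrm _ _ _ _ _ _ sumE prodE _ h3 h1 h2.
  - exact: growth_x3 hnrm _ _ _ _ _ _ sumE prodE _ h3 h1 h2.
  - exact: growth_y hnrm _ _ _ _ _ _ sumE prodE _ h1 h2 h3.
split; [apply: (transfer True) | apply: (transfer False)] => a; split.
- exact: growth_of_drazin.
- exact: drazin_of_growth.
- exact: growth_of_gdrazin.
- exact: gdrazin_of_growth.
Qed.
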